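(* Let $R$ be a finite principal left ideal ring and $P$ a multiplicative property on $R^n$. Let $C\subseteq R^n$ be a free left submodule such that $P[x]$ holds for all nonzero $x\in C$. Then there exist a respectful order $<$ on $R$ and an ordered basis $B$ of $R^n$ such that $C\subseteq C(<,B,P)$.
   Context: $R^\ast$ is the unit group of $R$. A property $P:R^n\to\{\text{true},\text{false}\}$ is multiplicative if $P[ux]=P[x]=P[xu]$ for all $u\in R^\ast$, $x\in R^n$. A total order $<$ on $R$ is respectful if for all nonzero $x,y\in R$ with $Rx\supsetneq Ry$ there is $\alpha\in R^\ast$ with $\alpha x<uy$ for all $u\in R^\ast$. Given an ordered basis $B=(b_1,\dots,b_n)$ of the free left module $R^n$, put $V_0=\{0\}$ and $V_i=Rb_1+\dots+Rb_i$. The lexicographic order on $R^n$: if $x\in V_{i-1}$ and $y\in V_i\setminus V_{i-1}$ then $x<y$; if $x\ne y$ both lie in $V_i\setminus V_{i-1}$, write $x=\sum_{j\le i}x_jb_j$, $y=\sum_{j\le i}y_jb_j$, let $k$ be the largest index with $x_k\ne y_k$, and set $x<y$ iff $x_k<y_k$ in $R$. Fix a set $\Gamma\subseteq R$ containing one generator of each nonzero left ideal of $R$. Greedy algorithm: $C_0=\{0\}$; for $i=1,\dots,n$, let $a_i$ be the smallest vector of $V_i\setminus V_{i-1}$ (if any) such that $P[\gamma a_i+c]$ is true for all $\gamma\in\Gamma$ and all $c\in C_{i-1}$; if such $a_i$ exists set $C_i=Ra_i+C_{i-1}$, otherwise $C_i=C_{i-1}$. The lexicode is $C(<,B,P):=C_n$.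 *)

(* Defs.v *)
From HB Require Import structures.
From mathcomp Require Import all_boot all_order all_algebra.
Set Implicit Arguments. Unset Strict Implicit. Unset Printing Implicit Defensive.
Import GRing.Theory.
Local Open Scope ring_scope.

Section Lexicodes.
Variable R : finNzRingType.

Definition isunit (u : R) : bool := [exists v : R, (u * v == 1) && (v * u == 1)].

Definition lideal (x : R) : {set R} := [set r * x | r : R].

Definition is_left_ideal (I : {set R}) : Prop :=
  0 \in I /\ (forall x y, x \in I -> y \in I -> x + y \in I) /\
  (forall r x, x \in I -> r * x \in I).

Definition principal_left_ideal_ring : Prop :=
  forall I : {set R}, is_left_ideal I -> exists x : R, I = lideal x.

Definition strict_total_order (lt : rel R) : Prop :=
  (forall x, ~~ lt x x) /\ (forall x y z, lt x y -> lt y z -> lt x z) /\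
  (forall x y, x != y -> lt x y || lt y x).

Definition respectful (lt : rel R) : Prop :=
  forall x y : R, x != 0 -> y != 0 -> lideal y \proper lideal x ->
    exists2 a : R, isunit a & forall u : R, isunit u -> lt (a * x) (u * y).

Variable n : nat.
Notation vec := 'rV[R]_n.

Definition rscale (x : vec) (u : R) : vec := map_mx (fun a => a * u) x.

Definition multiplicative (P : pred vec) : Prop :=
  forall (u : R) (x : vec), isunit u -> P (u *: x) = P x /\ P (rscale x u) = P x.

Definition is_ordered_basis (b : 'I_n -> vec) : Prop :=
  forall x : vec, exists! c : 'rV[R]_n, x = \sum_(j < n) c 0 j *: b j.

Definition is_left_submodule (C : {set vec}) : Prop :=
  0 \in C /\ (forall x y, x \in C -> y \in C -> x + y \in C) /\
  (forall r x, x \in C -> r *: x \in C).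

Definition is_free_left_submodule (C : {set vec}) : Prop :=
  is_left_submodule C /\
  exists (k : nat) (e : 'I_k -> vec), (forall j, e j \in C) /\
    forall x, x \in C -> exists! c : 'rV[R]_k, x = \sum_(j < k) c 0 j *: e j.

(* V_i = R b_1 + ... + R b_i  (0-based: the b_j with j < i) *)
Definition Vsp (b : 'I_n -> vec) (i : nat) : {set vec} :=
  [set x | [exists c : 'rV[R]_n, x == \sum_(j < n | (j < i)%N) c 0 j *: b j]].

(* coordinates w.r.t. b (unique when b is a basis) *)
Definition coords (b : 'I_n -> vec) (x : vec) : 'rV[R]_n :=
  odflt 0 [pick c : 'rV[R]_n | x == \sum_(j < n) c 0 j *: b j].

(* lexicographic order on R^n; level i : 'I_n stands for V_(i+1) \ V_i *)
Definition lexlt (lt : rel R) (b : 'I_n -> vec) (x y : vec) : bool :=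
  [exists i : 'I_n, (x \in Vsp b i) && (y \in Vsp b i.+1 :\: Vsp b i)] ||
  [exists i : 'I_n, [&& x \in Vsp b i.+1 :\: Vsp b i,
                        y \in Vsp b i.+1 :\: Vsp b i, x != y &
     [exists k : 'I_n, [&& coords b x 0 k != coords b y 0 k,
                           [forall j : 'I_n, (k < j)%N ==> (coords b x 0 j == coords b y 0 j)] &
                           lt (coords b x 0 k) (coords b y 0 k)]]]].

(* one step of the greedy algorithm (step i, 0-based, builds C_(i+1) from C_i) *)
Definition greedy_step (lt : rel R) (b : 'I_n -> vec) (P : pred vec)
    (Gamma : {set R}) (i : nat) (C : {set vec}) : {set vec} :=
  let cand := [set a in Vsp b i.+1 :\: Vsp b i |
                 [forall g : R, (g \in Gamma) ==> [forall c : vec, (c \in C) ==> P (g *: a + c)]]] in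
  match [pick a in cand | [forall a' : vec, (a' \in cand) && (a' != a) ==> lexlt lt b a a']] with
  | Some a => [set r *: a + c | r : R, c : vec in C]
  | None => C
  end.

Definition lexicode (lt : rel R) (b : 'I_n -> vec) (P : pred vec)
    (Gamma : {set R}) : {set vec} :=
  iteri n (greedy_step lt b P Gamma) [set 0].

End Lexicodes.

Definition generator_set (R : finNzRingType) (Gamma : {set R}) : Prop :=
  (forall g, g \in Gamma -> g != 0) /\
  forall I : {set R}, is_left_ideal I -> I != [set 0] ->
    exists! g, g \in Gamma /\ lideal g = I.

(* Main.v *)
Require Import Defs.
From HB Require Import structures.
From mathcomp Require Import all_boot all_order all_algebra.
Local Open Scope ring_scope.

(** Counting shows that a finite left principal ideal ring [R] satisfies [|N| |N^perp| <= |R|^n] for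
    every left submodule [N] of [R^n]: along a composition series of [R^n / N] it suffices that
    [|Hom(S, R)| <= |S|] for simple [S], which holds because the [S]-isotypic part of the left socle is
    a cyclic left ideal. Hence every functional on the free module [C] extends to [R^n], so [C] is a
    direct summand, and its complement is free by Lovasz's cancellation. Take a basis of [R^n] whose
    first [k] vectors span [C], and order [R] by decreasing size of the generated left ideal. In the
    first [k] steps, unit multiples of [b_i] are candidates and units precede nonunits, so the vector
    chosen has a unit leading coordinate and the greedy algorithm reaches [V_k = C]. *)

Set Implicit Arguments. Unset Strict Implicit. Unset Printing Implicit Defensive.
Import GRing.Theory.

(** * Counting through fibres *)

Lemma leq_card_fibers (T U : finType) (A : {set T}) (B : {set U}) (f : T -> U) m :
  {in A, forall x, f x \in B} ->
  {in A, forall x0, #|[set x in A | f x == f x0]| <= m}%N ->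
  (#|A| <= #|B| * m)%N.
Proof.
move=> fAB fib; rewrite -sum1_card (partition_big f [in B]) //=.
rewrite -sum_nat_const; apply: leq_sum => u _.
rewrite sum1dep_card; set F := [set _ in _ | _].
have [->|[x0]] := set_0Vmem F; first by rewrite cards0.
rewrite /F inE => /andP[Ax0 /eqP <-]; exact: fib.
Qed.

(** Möbius inversion on subsets: the count for supersets of [K] is the sum of the exact counts over
    all [L] containing [K]. By induction from large [K] downwards, the terms with [L != K] agree and
    cancel. *)
Lemma card_fibers_by_preimage (X Y T : finType)
    (f : X -> {set T}) (g : Y -> {set T}) (A : {set X}) :
  (forall K : {set T}, #|[set x in A | K \subset f x]| = #|[set y | K \subset g y]|) ->
  forall K : {set T}, #|[set x in A | f x == K]| = #|[set y | g y == K]|.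
Proof.
move=> eqfg K; have [d] := ubnP (#|T| - #|K|)%N.
elim: d K => // d IH K; rewrite ltnS => leKd.
have split_f : #|[set x in A | K \subset f x]| =
    (\sum_(L : {set T} | K \subset L) #|[set x in A | f x == L]|)%N.
  rewrite -sum1dep_card (partition_big f (fun L => K \subset L)) /=.
    apply: eq_bigr => L sKL; rewrite -sum1dep_card; apply: eq_bigl => x.
    by case: eqP => [->|]; rewrite ?sKL ?andbT ?andbF.
  by move=> x /andP[].
have split_g : #|[set y | K \subset g y]| =
    (\sum_(L : {set T} | K \subset L) #|[set y | g y == L]|)%N.
  rewrite -sum1dep_card (partition_big g (fun L => K \subset L)) //=.
  apply: eq_bigr => L sKL; rewrite -sum1dep_card; apply: eq_bigl => x.
  by case: eqP => [->|]; rewrite ?sKL ?andbT ?andbF.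
have := eqfg K; rewrite split_f split_g (bigD1 K) //= [in RHS](bigD1 K) //=.
suff -> : (\sum_(L : {set T} | (K \subset L) && (L != K)) #|[set x in A | f x == L]| =
   \sum_(L : {set T} | (K \subset L) && (L != K)) #|[set y | g y == L]|)%N.
  by move/addIn.
apply: eq_bigr => L /andP[sKL neLK]; apply: IH.
have ltKL : (#|K| < #|L|)%N by rewrite proper_card // properEneq eq_sym neLK.
apply: leq_trans leKd; rewrite ltn_sub2l //.
exact: leq_trans ltKL (max_card _).
Qed.

(** * Annihilators of maximal left ideals *)

Section FiniteRing.
Variable R : finNzRingType.

(** For a left ideal [M] this is Hom(R/M, R), a homomorphism being recorded by its value at 1. *)
Definition right_ann (M : {set R}) : {set R} :=
  [set t | [forall m, (m \in M) ==> (m * t == 0)]].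

Lemma right_annP (M : {set R}) t :
  reflect (forall m, m \in M -> m * t = 0) (t \in right_ann M).
Proof.
rewrite inE; apply: (iffP forallP) => [h m Mm|h m].
  by apply/eqP; have /implyP := h m; apply.
by apply/implyP => /h ->.
Qed.

Definition comb (T : {set R}) (a : {ffun R -> R}) : R := \sum_(t in T) a t * t.

Lemma combB T a b : comb T (a - b) = comb T a - comb T b.
Proof. by rewrite -sumrB; apply: eq_bigr => t _; rewrite !ffunE mulrBl. Qed.

Lemma comb_scale T c (a : {ffun R -> R}) : comb T [ffun t => c * a t] = c * comb T a.
Proof. by rewrite mulr_sumr; apply: eq_bigr => t _; rewrite ffunE mulrA. Qed.

Lemma comb_delta (T : {set R}) u : u \in T -> comb T [ffun t => (t == u)%:R] = u.
Proof.
move=> Tu; rewrite /comb (bigD1 u) //= ffunE eqxx mul1r big1 ?addr0 //.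
by move=> t /andP[_ /negPf ne]; rewrite ffunE ne mul0r.
Qed.

Lemma left_ideal_sum (M : {set R}) (I : finType) (Q : pred I) F :
  is_left_ideal M -> (forall i, Q i -> F i \in M) -> \sum_(i | Q i) F i \in M.
Proof.
by case=> M0 [MD _] MF; apply: (big_ind (fun x => x \in M)).
Qed.

Lemma left_idealB (M : {set R}) x y :
  is_left_ideal M -> x \in M -> y \in M -> x - y \in M.
Proof. by case=> _ [MD MM] Mx My; rewrite -mulN1r; apply: MD => //; apply: MM. Qed.

(** Coefficients need only lie in [M]: when [T] is inside [right_ann M] they matter only modulo [M],
    and the condition says that (R/M)^T embeds into R. *)
Definition independent (M T : {set R}) : bool :=
  [forall a : {ffun R -> R}, (comb T a == 0) ==> [forall t in T, a t \in M]].

Lemma independentP (M T : {set R}) :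
  reflect (forall a, comb T a = 0 -> {in T, forall t, a t \in M}) (independent M T).
Proof.
apply: (iffP forallP) => [h a a0 t Tt|h a].
  by have /implyP := h a; rewrite a0 eqxx => /(_ isT)/forall_inP; apply.
by apply/implyP => /eqP a0; apply/forall_inP; apply: h.
Qed.

(* [R / M] is simple, so the left ideals [R t] with [t \in right_ann M] are zero or copies of it. *)
Lemma exists_independent_span (M : {set R}) : is_left_ideal M ->
  (forall a, a \notin M -> exists b, 1 - b * a \in M) ->
  exists T : {set R}, [/\ T \subset right_ann M, independent M T &
    forall u, u \in right_ann M -> exists a, u = comb T a].
Proof.
move=> idM maxM.
pose Q (T : {set R}) := (T \subset right_ann M) && independent M T.
have Q0 : Q set0.
  by rewrite /Q sub0set; apply/independentP => a _ t; rewrite inE.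
have [T /maxsetP[/andP[sT indT] maxT] _] := maxset_exists Q0.
exists T; split=> // u Mu.
case: (boolP [exists a, u == comb T a]) => [/existsP[a ?]|/existsPn nT].
  by exists a; apply/eqP.
have Tu : u \notin T.
  by apply/negP=> Tu; move: (nT [ffun t => (t == u)%:R]); rewrite comb_delta ?eqxx.
suff: Q (u |: T).
  by move/maxT => /(_ (subsetUr _ _)) eT; move: Tu; rewrite -eT setU11.
rewrite /Q subUset sub1set Mu sT /=; apply/independentP => a.
rewrite /comb big_setU1 //= -/(comb T a) => a0.
(* Otherwise [a u] is left invertible modulo [M], and the relation expresses [u] through [T]. *)
have Mau : a u \in M.
  apply/negPn/negP=> /maxM[b Mb].
  move/right_annP: Mu => /(_ _ Mb); rewrite mulrBl mul1r -mulrA => /eqP.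
  rewrite subr_eq0 => /eqP eu; move: (nT [ffun t => - b * a t]).
  by rewrite comb_scale {1}eu (canRL (addrK _) a0) sub0r mulNr mulrN eqxx.
move: a0; rewrite (right_annP _ _ Mu) // add0r => a0 t.
by rewrite in_setU1 => /predU1P[-> //|]; apply: (independentP _ _ indT).
Qed.

(* The span of [T] is a direct sum of copies of [R / M]; since it is a cyclic left ideal [R w], the
   coefficients [w_t] of [w] are right independent over the endomorphism ring of [R / M], whence
   [sum d_t t |-> sum w_t d_t] embeds [right_ann M = Hom(R / M, R)] into [R / M]. *)
Lemma leq_card_right_ann (M : {set R}) : principal_left_ideal_ring R ->
  is_left_ideal M -> (forall a, a \notin M -> exists b, 1 - b * a \in M) ->
  (#|right_ann M| * #|M| <= #|R|)%N.
Proof.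
move=> pR idM maxM; have [M0 [MD MM]] := idM.
have [T [sT /independentP indT spanT]] := exists_independent_span idM maxM.
pose K := [set comb T a | a : {ffun R -> R}].
have /pR[w Kw] : is_left_ideal K.
  split; last split.
  - apply/imsetP; exists 0 => //; rewrite /comb big1 // => t _.
    by rewrite ffunE mul0r.
  - move=> _ _ /imsetP[a _ ->] /imsetP[b _ ->]; apply/imsetP; exists (a + b) => //.
    by rewrite /comb -big_split; apply: eq_bigr => t _; rewrite ffunE mulrDl.
  - move=> r _ /imsetP[a _ ->]; apply/imsetP; exists [ffun t => r * a t] => //.
    by rewrite comb_scale.
have /imsetP[c _ wc] : w \in K by rewrite Kw; apply/imsetP; exists 1; rewrite ?mul1r.
(* Each [t] is a multiple [a * w]; comparing coefficients modulo [M] gives [a * c s] congruent to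
   the Kronecker delta. *)
have solve t : t \in T -> exists a, forall s, s \in T -> a * c s - (s == t)%:R \in M.
  move=> Tt; have : t \in lideal w.
    rewrite -Kw; apply/imsetP; exists [ffun s => (s == t)%:R] => //.
    by rewrite comb_delta.
  case/imsetP=> a _ ta; exists a => s Ts.
  have := indT ([ffun s => a * c s] - [ffun s => (s == t)%:R]).
  rewrite combB comb_scale comb_delta // -wc -ta subrr => /(_ erefl s Ts).
  by rewrite !ffunE.
pose d (u : R) : {ffun R -> R} := odflt 0 [pick a : {ffun R -> R} | u == comb T a].
have dP u : u \in right_ann M -> u = comb T (d u).
  move=> /spanT[a ua]; rewrite /d; case: pickP => [? /eqP //|/(_ a)].
  by rewrite ua eqxx.
(* Since [m * u = 0], independence applies; so right multiplication by [d u t] is an endomorphism of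
   R/M. *)
have Md u m t : u \in right_ann M -> m \in M -> t \in T -> m * d u t \in M.
  move=> Mu Mm Tt; have := indT [ffun t => m * d u t].
  rewrite comb_scale -dP // (right_annP _ _ Mu) // => /(_ erefl t Tt).
  by rewrite ffunE.
pose psi u := \sum_(t in T) c t * d u t.
have psi_inj u u' : u \in right_ann M -> u' \in right_ann M ->
    psi u - psi u' \in M -> u = u'.
  move=> Mu Mu' Mpsi; apply/eqP; rewrite -subr_eq0 (dP u) // (dP u') // -combB.
  rewrite /comb big1 // => t Tt; apply: (right_annP _ _ (subsetP sT t Tt)).
  rewrite !ffunE; have [a aP] := solve t Tt.
  have : a * (psi u - psi u') \in M by apply: MM.
  pose D s := d u s - d u' s.
  have MDs m s : m \in M -> s \in T -> m * D s \in M.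
    by move=> Mm Ts; rewrite mulrBr; apply: left_idealB => //; apply: Md.
  (* With [a] from [solve], multiplication isolates the coefficient [D t] modulo [M]. *)
  have -> : a * (psi u - psi u') =
     D t + \sum_(s in T) (a * c s - (s == t)%:R) * D s.
    have {1}-> : D t = \sum_(s in T) (s == t)%:R * D s.
      rewrite (bigD1 t) //= eqxx mul1r big1 ?addr0 //.
      by move=> s /andP[_ /negPf->]; rewrite mul0r.
    rewrite -big_split -sumrB mulr_sumr; apply: eq_bigr => s _ /=.
    by rewrite -mulrDl [_%:R + _]addrC subrK -mulrBr mulrA.
  set X := \sum_(s in T) _ => MDX; rewrite -[_ - _](addrK X) -/(D t).
  by apply: left_idealB => //; apply: left_ideal_sum => // s Ts; apply: MDs; rewrite ?aP.
rewrite -cardsX -cardsT.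
pose h (p : R * R) := psi p.1 + p.2.
rewrite -(card_in_imset (f := h)) ?subset_leq_card ?subsetT //.
move=> [u m] [u' m']; rewrite !inE /= -/(right_ann M) => /andP[Mu Mm] /andP[Mu' Mm'].
rewrite /h /= => eqh.
have eu : u = u'.
  apply: psi_inj; rewrite ?inE //.
  have -> : psi u - psi u' = m' - m.
    by apply/eqP; rewrite subr_eq addrAC eq_sym subr_eq addrC eqh addrC.
  exact: left_idealB.
by move: eqh; rewrite eu => /addrI ->.
Qed.

End FiniteRing.

(** * Submodules of the free module and their annihilators *)

Section Annihilators.
Variables (R : finNzRingType) (n : nat).
Implicit Types (N : {set 'rV[R]_n}) (v x : 'rV[R]_n).

Definition perp N : {set 'cV[R]_n} := [set y | [forall x, (x \in N) ==> (x *m y == 0)]].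

Lemma perpP N (y : 'cV[R]_n) :
  reflect (forall x, x \in N -> x *m y = 0) (y \in perp N).
Proof.
rewrite inE; apply: (iffP forallP) => [h x Nx|h x].
  by apply/eqP; have /implyP := h x; apply.
by apply/implyP => /h ->.
Qed.

Lemma submoduleB N x y :
  is_left_submodule N -> x \in N -> y \in N -> x - y \in N.
Proof. by case=> _ [ND NZ] Nx Ny; rewrite -scaleN1r; apply: ND => //; apply: NZ. Qed.

Definition adjoin N v : {set 'rV[R]_n} := [set x | [exists r, x - r *: v \in N]].

Lemma adjoinP N v x : reflect (exists r, x - r *: v \in N) (x \in adjoin N v).
Proof. by rewrite inE; apply: existsP. Qed.

Lemma adjoin_submodule N v : is_left_submodule N -> is_left_submodule (adjoin N v).
Proof.
case=> N0 [ND NZ]; split; last split.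
- by apply/adjoinP; exists 0; rewrite scale0r subr0.
- move=> x y /adjoinP[r Nr] /adjoinP[s Ns]; apply/adjoinP; exists (r + s).
  by rewrite scalerDl opprD addrACA; apply: ND.
- move=> a x /adjoinP[r Nr]; apply/adjoinP; exists (a * r).
  by rewrite -scalerA -scalerBr; apply: NZ.
Qed.

Lemma sub_adjoin N v : N \subset adjoin N v.
Proof. by apply/subsetP=> x Nx; apply/adjoinP; exists 0; rewrite scale0r subr0. Qed.

Lemma mem_adjoin N v : is_left_submodule N -> v \in adjoin N v.
Proof. by case=> N0 _; apply/adjoinP; exists 1; rewrite scale1r subrr. Qed.

(** The annihilator of the class of [v] modulo [N], so that (N + Rv)/N is R modulo this ideal. *)
Definition transporter N v : {set R} := [set r | r *: v \in N].

Lemma transporter_ideal N v : is_left_submodule N -> is_left_ideal (transporter N v).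
Proof.
case=> N0 [ND NZ]; split; last split; first by rewrite inE scale0r.
  by move=> x y; rewrite !inE scalerDl; apply: ND.
by move=> r x; rewrite !inE -scalerA; apply: NZ.
Qed.

(** Map (x, r) to x + rv; two pairs with the same image have second components differing by an
    element of the transporter. *)
Lemma leq_card_adjoin N v : is_left_submodule N ->
  (#|N| * #|R| <= #|adjoin N v| * #|transporter N v|)%N.
Proof.
move=> sN; have [_ [ND _]] := sN; rewrite -cardsT -cardsX.
apply: (leq_card_fibers (f := fun p => p.1 + p.2 *: v)).
  move=> [x r]; rewrite !inE andbT /= => Nx; apply/existsP; exists r.
  by rewrite addrK.
move=> [x r]; rewrite inE => /andP[/= Nx _].
rewrite -(card_in_imset (f := fun p => p.2 - r)).
  apply/subset_leq_card/subsetP => _ /imsetP[[y s] + ->].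
  rewrite !inE andbT /= => /andP[Ny /eqP eq_yx]; rewrite scalerBl.
  have -> : s *: v - r *: v = x - y.
    by apply/eqP; rewrite subr_eq addrAC eq_sym subr_eq -eq_yx addrC.
  exact: submoduleB.
move=> [y s] [y' s'] /[!inE] /= /andP[_ /eqP e] /andP[_ /eqP e'].
by move/addIr => es; move: e; rewrite -e' es => /addIr ->.
Qed.

(** Evaluate functionals at [v]: those that vanish on [N] and agree at [v] differ by one vanishing
    on N + Rv. *)
Lemma leq_card_perp_adjoin N v : is_left_submodule N ->
  (#|perp N| <= #|right_ann (transporter N v)| * #|perp (adjoin N v)|)%N.
Proof.
move=> sN; apply: (leq_card_fibers (f := fun y => (v *m y) 0 0)).
  move=> y /perpP Ny; apply/right_annP => r; rewrite inE => /Ny.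
  by rewrite -scalemxAl => /matrixP/(_ 0 0); rewrite !mxE.
move=> y0 Ny0; rewrite -(card_imset _ (addIr (- y0))).
apply/subset_leq_card/subsetP => _ /imsetP[y + ->].
rewrite inE => /andP[/perpP Ny /eqP evy]; apply/perpP => x /adjoinP[r Nx].
have vy0 : v *m (y - y0) = 0.
  by rewrite mulmxBr [v *m y]mx11_scalar [v *m y0]mx11_scalar evy subrr.
rewrite -[x](subrK (r *: v)) mulmxDl -scalemxAl vy0 scaler0 addr0 mulmxBr.
by rewrite Ny // (perpP _ _ Ny0) // subrr.
Qed.

Lemma leq_card_perp N : principal_left_ideal_ring R -> is_left_submodule N ->
  (#|N| * #|perp N| <= #|R| ^ n)%N.
Proof.
move=> pR; have [d] := ubnP (#|'rV[R]_n| - #|N|)%N.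
elim: d N => // d IH N; rewrite ltnS => leNd sN.
have [/subsetP sTN|] := boolP (setT \subset N).
  suff -> : perp N = [set 0].
    by rewrite cards1 muln1 (leq_trans (max_card _)) // card_mx mul1n.
  apply/setP=> y; rewrite in_set1; apply/idP/eqP => [|->].
    move/perpP=> Ny; rewrite -[y]mul1mx; apply/row_matrixP => i.
    by rewrite row_mul Ny ?sTN ?inE // row0.
  by apply/perpP => x _; rewrite mulmx0.
case/subsetPn => v0 _ Nv0.
(* Minimality of |N + Rv| makes (N + Rv)/N simple: if [a *: v] is outside [N], adjoining it already
   yields [v]. *)
case: (@arg_minnP _ v0 [pred v | v \notin N] (fun v => #|adjoin N v|) Nv0) => v Nv minv.
pose M := transporter N v.
have sNv := adjoin_submodule v sN.
have maxM a : a \notin M -> exists b, 1 - b * a \in M.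
  rewrite inE => Nav; have: v \in adjoin N (a *: v).
    suff -> : adjoin N (a *: v) = adjoin N v by apply: mem_adjoin.
    apply/eqP; rewrite eqEcard minv // andbT.
    apply/subsetP=> x /adjoinP[r Nx]; apply/adjoinP; exists (r * a).
    by rewrite -scalerA.
  case/adjoinP=> b Nb; exists b.
  by rewrite inE scalerBl scale1r -scalerA.
have ltN : (#|N| < #|adjoin N v|)%N.
  apply/proper_card/properP; split; first exact: sub_adjoin.
  by exists v; first exact: mem_adjoin.
have leNv : (#|adjoin N v| * #|perp (adjoin N v)| <= #|R| ^ n)%N.
  apply: IH sNv; apply: leq_trans leNd; rewrite ltn_sub2l //.
  exact: leq_trans ltN (max_card _).
have := leq_card_right_ann pR (transporter_ideal v sN) maxM.
have := leq_card_perp_adjoin v sN; have := leq_card_adjoin v sN.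
rewrite -/M => leA leP leM.
have R0 : (0 < #|R|)%N by apply/card_gt0P; exists 0.
(* After multiplying by |R|, the bounds [leA], [leP], [leM] and the induction hypothesis [leNv]
   combine by products. *)
rewrite -(leq_pmul2r R0) mulnAC.
apply: leq_trans (leq_mul leA leP) _.
by rewrite [(#|right_ann M| * _)%N]mulnC mulnACA [(#|M| * _)%N]mulnC; apply: leq_mul.
Qed.

End Annihilators.

(** * Splitting off a free submodule and completing its basis *)

(** The row image [N] has |R|^k elements and the fibres of y -> Ey are cosets of [perp N]. The bound
    on |N| |perp N| therefore forces the column map to be onto, and preimages of the unit columns
    form [B]. *)
Lemma row_injective_right_inverse (R : finNzRingType) k n (E : 'M[R]_(k, n)) :
  principal_left_ideal_ring R -> injective (fun c : 'rV_k => c *m E) ->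
  exists B : 'M_(n, k), E *m B = 1%:M.
Proof.
move=> pR injE; pose N := [set c *m E | c : 'rV_k].
have sN : is_left_submodule N.
  split; last split; first by apply/imsetP; exists 0; rewrite ?mul0mx.
    move=> _ _ /imsetP[c _ ->] /imsetP[d _ ->]; apply/imsetP; exists (c + d) => //.
    by rewrite mulmxDl.
  move=> r _ /imsetP[c _ ->]; apply/imsetP; exists (r *: c) => //.
  by rewrite scalemxAl.
have R0 : (0 < #|R|)%N by apply/card_gt0P; exists 0.
pose F := [set E *m y | y : 'cV_n].
have leF : (#|R| ^ n <= #|F| * #|perp N|)%N.
  rewrite -{1}[n]muln1 -card_mx -cardsT.
  apply: (leq_card_fibers (f := mulmx E)); first by move=> y _; apply: imset_f.
  move=> y0 _; rewrite -(card_imset _ (addIr (- y0))).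
  apply/subset_leq_card/subsetP => _ /imsetP[y + ->].
  rewrite !inE /= => /eqP ey; apply/forallP => x; apply/implyP => /imsetP[c _ ->].
  by rewrite -mulmxA mulmxBr ey subrr mulmx0.
have FT : F = setT.
  apply/eqP; rewrite eqEcard subsetT cardsT card_mx muln1 /=.
  have cN : #|N| = (#|R| ^ k)%N by rewrite card_imset // card_mx mul1n.
  have perp_gt0 : (0 < #|perp N|)%N.
    by apply/card_gt0P; exists 0; apply/perpP=> x _; rewrite mulmx0.
  rewrite -cN -(leq_pmul2r perp_gt0); apply: leq_trans leF.
  exact: leq_card_perp.
have solve i : exists y, E *m y == delta_mx i 0 :> 'cV_k.
  have : delta_mx i 0 \in F by rewrite FT inE.
  by case/imsetP=> y _ ->; exists y.
exists (\matrix_(j, i) xchoose (solve i) j 0); apply/matrixP => i j.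
have /eqP/matrixP/(_ i 0) := xchooseP (solve j); rewrite !mxE andbT => <-.
by apply: eq_bigr => l _; rewrite !mxE.
Qed.

(* Lovasz's cancellation: [R^(k+m) = R^k + ker B], so for every [K] the homomorphisms killing [K] from
   [R^m] to [ker B] and to [R^m] are equinumerous. Hence so are the injective ones, and the identity
   is one. *)
Lemma complete_right_invertible (R : finNzRingType) k m
    (E : 'M[R]_(k, k + m)) (B : 'M[R]_(k + m, k)) : E *m B = 1%:M ->
  exists D : 'M_(m, k + m), injective (fun c : 'rV_(k + m) => c *m col_mx E D).
Proof.
move=> EB.
pose ker p (A : 'M[R]_(m, p)) : {set 'rV[R]_m} := [set x | x *m A == 0].
pose Q : {set 'M[R]_(m, k + m)} := [set A | A *m B == 0].
have kerP p (A : 'M[R]_(m, p)) (K : {set 'rV[R]_m}) :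
    reflect (forall x, x \in K -> x *m A = 0) (K \subset ker p A).
  apply: (iffP subsetP) => [h x Kx|h x Kx]; last by rewrite inE h.
  by apply/eqP; have := h x Kx; rewrite inE.
have eqQ (K : {set 'rV[R]_m}) :
    #|[set A in Q | K \subset ker _ A]| = #|[set A : 'M[R]_m | K \subset ker _ A]|.
  set QK := [set A in Q | _]; set IK := [set A | _].
  pose Z := [set A : 'M[R]_(m, k) | K \subset ker _ A].
  have Z0 : (0 < #|Z|)%N.
    by apply/card_gt0P; exists 0; rewrite inE; apply/kerP=> x _; rewrite mulmx0.
  apply/eqP; rewrite -(eqn_pmul2r Z0) -!cardsX.
  (* Maps killing [K] are counted twice, through R^(k+m) = ker B + R^k and through the block
     splitting R^k + R^m; the common nonzero factor |Z| cancels. *)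
  pose HK := [set A : 'M[R]_(m, k + m) | K \subset ker _ A].
  have <- : #|HK| = #|setX QK Z|.
    pose f (A : 'M[R]_(m, k + m)) := (A - A *m B *m E, A *m B).
    have f_inj : injective f by move=> A A' [+ eB]; rewrite eB; apply: addIr.
    rewrite -(card_imset _ f_inj); apply: eq_card => -[A D].
    rewrite !inE /=; apply/imsetP/idP.
      case=> A'; rewrite inE => /kerP KA' [-> ->].
      rewrite mulmxBl -[A' *m B *m E *m B]mulmxA EB mulmx1 subrr eqxx /=.
      by apply/andP; split; apply/kerP => x Kx; rewrite ?mulmxBr !mulmxA KA' ?mul0mx ?subrr.
    case/andP=> /andP[/eqP AB /kerP KA] /kerP KD.
    exists (A + D *m E).
      by rewrite inE; apply/kerP=> x Kx; rewrite mulmxDr mulmxA KA ?KD ?mul0mx ?addr0.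
    by rewrite /f mulmxDl AB add0r -[D *m E *m B]mulmxA EB mulmx1 addrK.
  have <- : #|HK| = #|setX IK Z|.
    pose f (A : 'M[R]_(m, k + m)) := (rsubmx A, lsubmx A).
    have f_inj : injective f.
      by move=> A A' [er el]; rewrite -[A]hsubmxK -[A']hsubmxK er el.
    rewrite -(card_imset _ f_inj); apply: eq_card => -[A D].
    rewrite !inE /=; apply/imsetP/idP.
      case=> A'; rewrite inE => /kerP KA' [-> ->].
      apply/andP; split; apply/kerP => x /KA' ; rewrite -[A']hsubmxK mul_mx_row.
        by move/(congr1 rsubmx); rewrite !row_mxKr linear0.
      by move/(congr1 lsubmx); rewrite !row_mxKl linear0.
    case/andP=> /kerP KA /kerP KD; exists (row_mx D A).
      by rewrite inE; apply/kerP=> x Kx; rewrite mul_mx_row KA ?KD ?row_mx0.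
    by rewrite /f row_mxKl row_mxKr.
  by [].
(* The kernel of the identity is zero, so this compares the injective maps. *)
have := card_fibers_by_preimage eqQ (ker m 1%:M).
set c := #|_| => cI.
have /card_gt0P[D] : (0 < c)%N.
  by rewrite cI; apply/card_gt0P; exists 1%:M; rewrite inE.
rewrite !inE => /andP[/eqP DB /eqP kerD]; exists D => c1 c2 /= /eqP.
rewrite -subr_eq0 -mulmxBl => /eqP; move: (c1 - c2) (subr_eq0 c1 c2) => x eq_x x0.
apply/eqP; rewrite -eq_x; move: x0; rewrite -[x]hsubmxK mul_row_col => x0.
(* Multiplying the relation by [B] kills the [D] part and leaves the coefficients on [E]. *)
have l0 : lsubmx x = 0.
  have := congr1 (mulmx^~ B) x0; rewrite /= mulmxDl -!mulmxA EB DB.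
  by rewrite mulmx0 addr0 mulmx1 mul0mx.
have r0 : rsubmx x = 0.
  have : rsubmx x \in ker _ D by rewrite inE; move: x0; rewrite l0 mul0mx add0r => ->.
  by rewrite kerD inE mulmx1 => /eqP.
by rewrite l0 r0 row_mx0.
Qed.

(** * Minima, units and a respectful order *)

Lemma exists_minimum (T : finType) (A : {set T}) (lt : rel T) :
  (forall x, ~~ lt x x) -> (forall x y z, lt x y -> lt y z -> lt x z) ->
  {in A &, forall x y, x != y -> lt x y || lt y x} -> A != set0 ->
  exists2 a, a \in A & forall y, y \in A -> y != a -> lt a y.
Proof.
move=> irr tr tot /set0Pn[x0 Ax0].
(* An element with the fewest predecessors in [A] is least. *)
case: (@arg_minnP _ x0 [in A] (fun x => #|[set y in A | lt y x]|) Ax0) => a Aa mina.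
exists a => // y Ay ya; have := tot a y Aa Ay; rewrite eq_sym => /(_ ya)/orP[] // lt_ya.
have := mina y Ay; rewrite leqNgt => /negP[].
apply/proper_card/properP; split.
  by apply/subsetP=> z; rewrite !inE => /andP[-> /tr]; apply.
by exists y; rewrite !inE Ay //= (negPf (irr y)).
Qed.

Section Units.
Variable R : finNzRingType.

Lemma isunitP (u : R) : reflect (exists v, u * v = 1 /\ v * u = 1) (isunit u).
Proof.
apply: (iffP existsP) => [[v /andP[/eqP ? /eqP ?]]|[v [uv vu]]]; exists v => //.
by rewrite uv vu !eqxx.
Qed.

(** Right multiplication by [s] is injective, hence onto by finiteness; so [s] also has a left
    inverse, which must be [x]. *)
Lemma left_inverse_isunit (s x : R) : s * x = 1 -> isunit x.
Proof.
move=> sx; have inj_s : injective (fun y => y * s).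
  by apply: (can_inj (g := fun y => y * x)) => y; rewrite -mulrA sx mulr1.
have [t _ ts] := injF_bij inj_s; have := ts 1; set u := t 1 => us.
apply/isunitP; exists s; split=> //.
by rewrite -[x]mul1r -us -[u * s * x]mulrA sx mulr1.
Qed.

Lemma proper_lideal1 (x : R) : ~~ isunit x -> lideal x \proper lideal 1.
Proof.
move=> Ux; apply/properP; split.
  by apply/subsetP=> _ /imsetP[r _ ->]; apply/imsetP; exists (r * x); rewrite ?mulr1.
exists 1; first by apply/imsetP; exists 1; rewrite ?mulr1.
by apply/imsetP=> -[s _ /esym/left_inverse_isunit Vx]; rewrite Vx in Ux.
Qed.

Lemma lideal_unit (u x : R) : isunit u -> lideal (u * x) = lideal x.
Proof.
case/isunitP=> v [_ vu]; apply/setP=> y; apply/imsetP/imsetP => -[r _ ->].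
  by exists (r * u); rewrite ?mulrA.
by exists (r * v) => //; rewrite !mulrA -(mulrA r v) vu mulr1.
Qed.

(** A two-digit number in base |R|: larger left ideals come first, and [enum_rank] breaks ties. *)
Definition ideal_rank (x : R) : nat :=
  ((#|R| - #|lideal x|) * #|R| + enum_rank x)%N.

Definition ideal_lt : rel R := fun x y => (ideal_rank x < ideal_rank y)%N.

Lemma ideal_lt_total : strict_total_order ideal_lt.
Proof.
split; first by move=> x; rewrite /ideal_lt ltnn.
split; first by move=> x y z; apply: ltn_trans.
move=> x y; rewrite /ideal_lt -neq_ltn; apply: contra_neq => eq_rk.
apply: enum_rank_inj; apply: val_inj.
have R0 : (0 < #|R|)%N by apply/card_gt0P; exists 0.
have := congr1 (modn^~ #|R|) eq_rk.
by rewrite /= /ideal_rank !modnMDl !modn_small.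
Qed.

(** The factor 1 suffices: unit multiples of [y] generate the same ideal, so their leading digit
    stays strictly above that of [x]. *)
Lemma ideal_lt_respectful : respectful ideal_lt.
Proof.
move=> x y _ _ ltyx; exists 1; first by apply/isunitP; exists 1; rewrite mulr1.
move=> u Uu; rewrite mul1r /ideal_lt /ideal_rank (lideal_unit _ Uu).
have lt_c : (#|R| - #|lideal x| < #|R| - #|lideal y|)%N.
  apply: ltn_sub2l (proper_card ltyx).
  exact: leq_trans (proper_card ltyx) (max_card _).
apply: (@leq_trans ((#|R| - #|lideal x|).+1 * #|R|)).
  by rewrite mulSn addnC ltn_add2r.
by apply: leq_trans (leq_addr _ _); rewrite leq_mul2r lt_c orbT.
Qed.

End Units.

(** * The greedy algorithm along a basis *)

Section Greedy.
Variables (R : finNzRingType) (n : nat) (b : 'I_n -> 'rV[R]_n).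
Hypothesis basis_b : is_ordered_basis b.
Variables (lt : rel R) (P : pred 'rV[R]_n) (Gamma : {set R}).
Hypothesis lt_total : strict_total_order lt.
Hypothesis lt_respectful : respectful lt.
Hypothesis Gamma_neq0 : forall g, g \in Gamma -> g != 0.

Lemma coordsK (x : 'rV[R]_n) : x = \sum_(j < n) coords b x 0 j *: b j.
Proof.
have [c [cx _]] := basis_b x; rewrite /coords; case: pickP => [? /eqP //|/(_ c)].
by rewrite -cx eqxx.
Qed.

Lemma coords_unique (x : 'rV[R]_n) (c : 'rV[R]_n) : x = \sum_(j < n) c 0 j *: b j -> coords b x = c.
Proof.
by have [d [_ d_uniq]] := basis_b x; move=> /d_uniq <-; rewrite (d_uniq _ (coordsK x)).
Qed.

Lemma coords_inj : injective (coords b).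
Proof. by move=> x y e; rewrite [x]coordsK e -coordsK. Qed.

Lemma coordsD (x y : 'rV[R]_n) : coords b (x + y) = coords b x + coords b y.
Proof.
apply: coords_unique; rewrite {1}[x]coordsK {1}[y]coordsK -big_split.
by apply: eq_bigr => j _; rewrite mxE scalerDl.
Qed.

Lemma coordsZ r (x : 'rV[R]_n) : coords b (r *: x) = r *: coords b x.
Proof.
apply: coords_unique; rewrite {1}[x]coordsK scaler_sumr.
by apply: eq_bigr => j _; rewrite mxE scalerA.
Qed.

Lemma coords0 : coords b 0 = 0.
Proof. by rewrite -[0 in LHS](scale0r 0) coordsZ scale0r. Qed.

Lemma coords_basis i : coords b (b i) = delta_mx 0 i.
Proof.
apply: coords_unique; rewrite (bigD1 i) //= mxE !eqxx scale1r big1 ?addr0 //.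
by move=> j /negPf ne; rewrite mxE ne andbF scale0r.
Qed.

Lemma VspP i x :
  reflect (forall j : 'I_n, (i <= j)%N -> coords b x 0 j = 0) (x \in Vsp b i).
Proof.
rewrite inE; apply: (iffP existsP) => [[c /eqP ->] j le_ij|h].
  rewrite (@coords_unique _ (\row_j if (j < i)%N then c 0 j else 0)).
    by rewrite mxE ltnNge le_ij.
  rewrite [LHS]big_mkcond; apply: eq_bigr => l _; rewrite mxE.
  by case: ifP; rewrite // scale0r.
exists (coords b x); rewrite {1}[x]coordsK [X in _ == X]big_mkcond; apply/eqP.
by apply: eq_bigr => j _; case: ltnP => // /h ->; rewrite scale0r.
Qed.

Lemma Vsp0 : Vsp b 0 = [set 0].
Proof.
apply/setP=> x; rewrite in_set1; apply/VspP/eqP => [h|-> j _]; last by rewrite coords0 mxE.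
by apply: coords_inj; apply/rowP => j; rewrite coords0 mxE h.
Qed.

Lemma VspS_coord (i : 'I_n) x :
  (x \in Vsp b i) = (x \in Vsp b i.+1) && (coords b x 0 i == 0).
Proof.
apply/VspP/andP => [h|[/VspP h /eqP xi] j].
  by split; [apply/VspP=> j /ltnW/h | apply/eqP/h].
by rewrite leq_eqVlt => /predU1P[eij|/h //]; rewrite -(val_inj eij).
Qed.

Lemma sub_Vsp i j : (i <= j)%N -> Vsp b i \subset Vsp b j.
Proof.
move=> le_ij; apply/subsetP=> x /VspP h; apply/VspP => l le_jl.
exact/h/(leq_trans le_ij).
Qed.

Definition coord_lt (c d : 'rV[R]_n) : bool :=
  [exists k : 'I_n, [&& c 0 k != d 0 k,
    [forall j : 'I_n, (k < j)%N ==> (c 0 j == d 0 j)] & lt (c 0 k) (d 0 k)]].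

Lemma coord_ltP (c d : 'rV[R]_n) :
  reflect (exists k : 'I_n, (forall j : 'I_n, (k < j)%N -> c 0 j = d 0 j) /\
                            lt (c 0 k) (d 0 k))
    (coord_lt c d).
Proof.
apply: (iffP existsP) => -[k].
  by case/and3P=> _ /'forall_implyP h l; exists k; split=> // j /h/eqP.
case=> h l; exists k; rewrite l andbT; apply/andP; split.
  by apply: contraL l => /eqP->; case: lt_total.
by apply/'forall_implyP=> j /h/eqP.
Qed.

Lemma coord_lt_irr c : ~~ coord_lt c c.
Proof. by apply/coord_ltP => -[k [_]]; apply/negP; case: lt_total. Qed.

Lemma coord_lt_trans c d e : coord_lt c d -> coord_lt d e -> coord_lt c e.
Proof.
have [_ [tr _]] := lt_total.
move=> /coord_ltP[k [hk lk]] /coord_ltP[l [hl ll]]; apply/coord_ltP.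
case: (ltngtP k l) => [ltkl|ltlk|/val_inj ekl].
- exists l; rewrite hk //; split=> // j ltlj.
  by rewrite hk ?hl // (ltn_trans ltkl).
- exists k; rewrite -hl //; split=> // j ltkj.
  by rewrite hk ?hl // (ltn_trans ltlk).
exists k; split; last by apply: tr lk _; rewrite ekl.
by move=> j ltkj; rewrite hk ?hl // -ekl.
Qed.

Lemma coord_lt_total (c d : 'rV[R]_n) : c != d -> coord_lt c d || coord_lt d c.
Proof.
have [_ [_ tot]] := lt_total.
move=> ne_cd; have [k0 ne0] : exists k, c 0 k != d 0 k.
  apply/existsP; apply: contraNT ne_cd => /existsPn h.
  by apply/eqP/rowP => j; apply/eqP; have := h j; rewrite negbK.
case: (@arg_maxnP _ k0 [pred k | c 0 k != d 0 k] val ne0) => k /= nek maxk.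
have hk (j : 'I_n) : (k < j)%N -> c 0 j = d 0 j.
  by move=> ltkj; apply/eqP; apply: contraLR ltkj => /maxk; rewrite -leqNgt.
by have /orP[l|l] := tot _ _ nek; apply/orP; [left|right]; apply/coord_ltP;
  exists k; split=> // j /hk.
Qed.

(** The spaces V_i are nested, so the clause of [lexlt] for different levels cannot hold here. *)
Lemma lexlt_level (i : 'I_n) x y :
  x \in Vsp b i.+1 :\: Vsp b i -> y \in Vsp b i.+1 :\: Vsp b i -> x != y ->
  lexlt lt b x y = coord_lt (coords b x) (coords b y).
Proof.
move=> Vx Vy ne_xy; rewrite /lexlt; apply/orP/idP.
  case=> /existsP[j]; last by case/and4P.
  case/andP=> Vxj; rewrite in_setD => /andP[Vyj Vyj'].
  move: Vx Vy; rewrite !in_setD => /andP[Vxi _] /andP[Vyi Vyi'].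
  case: (leqP j i) => [leji|ltij]; last by rewrite (subsetP (sub_Vsp ltij)) in Vyj.
  by rewrite (subsetP (sub_Vsp leji)) in Vxi.
move=> lexy; right; apply/existsP; exists i.
by apply/and4P; split.
Qed.

(** Unit multiples of [b i] are candidates, and respectfulness puts some unit below any nonzero
    nonunit. The least candidate thus has a unit coordinate at [i], and with V_i it spans
    V_(i+1). *)
Lemma greedy_step_level (i : 'I_n) :
  (forall x, x \in Vsp b i.+1 -> x != 0 -> P x) ->
  greedy_step lt b P Gamma i (Vsp b i) = Vsp b i.+1.
Proof.
move=> PV; rewrite /greedy_step; set cand := [set a in _ | _].
have [lt_irr [lt_trans _]] := lt_total.
have cand_level a : a \in cand -> a \in Vsp b i.+1 :\: Vsp b i.
  by rewrite inE => /andP[].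
have cand_unit u : isunit u -> u *: b i \in cand.
  case/isunitP=> v [uv _].
  have cub : coords b (u *: b i) 0 i = u.
    by rewrite coordsZ coords_basis !mxE !eqxx mulr1.
  have Vub : u *: b i \in Vsp b i.+1.
    apply/VspP=> j ltij; rewrite coordsZ coords_basis !mxE eqxx /=.
    by rewrite -val_eqE gtn_eqF // mulr0.
  have reg r : r * u = 0 -> r = 0.
    by move=> ru; rewrite -[r]mulr1 -uv mulrA ru mul0r.
  rewrite inE in_setD Vub andbT VspS_coord Vub cub /=; apply/andP; split.
    by apply/eqP=> u0; move: (oner_neq0 R); rewrite -uv u0 mul0r eqxx.
  apply/'forall_implyP=> g /Gamma_neq0 g0; apply/'forall_implyP=> c Vc.
  (* The coordinate [g * u] is nonzero because [u] is a unit, so the tested vector is a nonzero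
     element of V_(i+1). *)
  have Vgc : coords b (g *: (u *: b i) + c) 0 i = g * u.
    rewrite coordsD coordsZ !mxE cub.
    by move: Vc; rewrite VspS_coord => /andP[_ /eqP->]; rewrite addr0.
  apply: PV.
    apply/VspP=> j ltij; rewrite coordsD coordsZ !mxE (VspP _ _ Vub) //.
    by rewrite (VspP _ _ Vc) ?mulr0 ?addr0 // ltnW.
  apply: contraNneq g0 => gc0; apply/eqP/reg.
  by rewrite -Vgc gc0 coords0 mxE.
case: pickP => [a|none].
  case/andP=> Ca /'forall_implyP mina.
  have /[!in_setD]/andP[Vai Va] := cand_level a Ca.
  have ai0 : coords b a 0 i != 0 by move: Vai; rewrite VspS_coord Va.
  have Ua : isunit (coords b a 0 i).
    (* A nonunit coordinate would place some [u *: b i] below [a]; with minimality, [a] would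
       precede itself. *)
    apply: contraNT (coord_lt_irr (coords b a)) => nUa.
    have [u Uu ltu] := lt_respectful (oner_neq0 R) ai0 (proper_lideal1 nUa).
    have {}ltu : lt u (coords b a 0 i).
      have := ltu 1; rewrite mulr1 mul1r; apply.
      by apply/isunitP; exists 1; rewrite mulr1.
    have cub : coords b (u *: b i) 0 i = u.
      by rewrite coordsZ coords_basis !mxE !eqxx mulr1.
    have Cu := cand_unit u Uu.
    have ne_ua : u *: b i != a by apply: contraNneq nUa => <-; rewrite cub.
    have := mina (u *: b i); rewrite Cu ne_ua => /(_ isT).
    rewrite (@lexlt_level i) ?cand_level // 1?eq_sym //.
    move=> lt_a; apply: (coord_lt_trans lt_a); apply/coord_ltP; exists i.
    rewrite cub; split=> // j ltij; rewrite (VspP _ _ Va) //.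
    by have /setDP[Vu _] := cand_level _ Cu; rewrite (VspP _ _ Vu).
  have [v [_ va]] := isunitP _ Ua.
  apply/setP=> x; apply/imset2P/idP.
    case=> r c _ Vc ->; apply/VspP=> j ltij; rewrite coordsD coordsZ !mxE.
    by rewrite (VspP _ _ Va) // (VspP _ _ Vc) ?mulr0 ?addr0 // ltnW.
  (* This [r] clears the coordinate at [i], so [x - r *: a] falls into V_i. *)
  move=> Vx; pose r := coords b x 0 i * v.
  exists r (x - r *: a) => //; last by rewrite addrC subrK.
  rewrite -scaleNr; apply/VspP=> j; rewrite coordsD coordsZ !mxE leq_eqVlt.
  case/predU1P=> [/val_inj <-|ltij].
    by rewrite mulNr -mulrA va mulr1 subrr.
  by rewrite (VspP _ _ Va) // (VspP _ _ Vx) // mulr0 addr0.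
(* The choice cannot fail: candidates exist and have a least element. *)
have [||||a Ca mina] := @exists_minimum _ cand (fun x y => coord_lt (coords b x) (coords b y)).
- by move=> x; apply: coord_lt_irr.
- by move=> x y z; apply: coord_lt_trans.
- by move=> x y _ _ ne; apply: coord_lt_total; rewrite (inj_eq coords_inj).
- by apply/set0Pn; exists (1 *: b i); apply/cand_unit/isunitP; exists 1; rewrite mulr1.
have := none a; rewrite Ca /= => /negP[]; apply/'forall_implyP => a' /andP[Ca' ne].
by rewrite (@lexlt_level i) ?cand_level ?mina // eq_sym.
Qed.

Lemma sub_greedy_step i (C : {set 'rV[R]_n}) : C \subset greedy_step lt b P Gamma i C.
Proof.
rewrite /greedy_step; case: pickP => // a _; apply/subsetP=> x Cx.
by apply/imset2P; exists 0 x; rewrite ?scale0r ?add0r.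
Qed.

(** The first [k] steps build exactly V_k; later steps only enlarge the code. *)
Lemma Vsp_sub_lexicode k : (k <= n)%N ->
  (forall x, x \in Vsp b k -> x != 0 -> P x) ->
  Vsp b k \subset lexicode lt b P Gamma.
Proof.
move=> lekn PV.
have level i : (i <= k)%N -> iteri i (greedy_step lt b P Gamma) [set 0] = Vsp b i.
  elim: i => [|i IH] ltik; first by rewrite Vsp0.
  rewrite iteriS IH; last exact: ltnW.
  apply: (greedy_step_level (i := Ordinal (leq_trans ltik lekn))) => x Vx.
  exact/PV/(subsetP (sub_Vsp ltik)).
have later m : Vsp b k \subset iteri (k + m) (greedy_step lt b P Gamma) [set 0].
  elim: m => [|m IH]; first by rewrite addn0 level.
  by rewrite addnS iteriS; apply: subset_trans IH (sub_greedy_step _ _).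
by have := later (n - k)%N; rewrite subnKC.
Qed.

End Greedy.

(** * Bases from matrices and the final assembly *)

(** By finiteness an injective self-map of R^n is bijective. *)
Lemma injective_rows_basis (R : finNzRingType) n (M : 'M[R]_n) :
  injective (fun c : 'rV_n => c *m M) -> is_ordered_basis (fun i => row i M).
Proof.
move=> injM x; have [f _ fK] := injF_bij injM; exists (f x); split.
  by rewrite -mulmx_sum_row fK.
by move=> c; rewrite -mulmx_sum_row => ->; apply: injM; rewrite fK.
Qed.

Lemma Vsp_col_mx (R : finNzRingType) k m (E : 'M[R]_(k, k + m)) (D : 'M_(m, k + m))
    (x : 'rV_(k + m)) :
  x \in Vsp (fun i => row i (col_mx E D)) k -> exists c : 'rV_k, x = c *m E.
Proof.
rewrite inE => /existsP[c /eqP->]; exists (lsubmx c).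
rewrite big_split_ord /= [X in _ + X]big_pred0 ?addr0; last first.
  by move=> j; rewrite /= ltnNge leq_addr.
rewrite mulmx_sum_row; apply: eq_big => [i|i _]; first by rewrite /= ltn_ord.
by rewrite mxE rowKu.
Qed.

(* [GRing.Theory] exports another [multiplicative]. *)
Import Defs.

Theorem mainTheorem11 (R : finNzRingType) (n : nat) (P : pred 'rV[R]_n)
    (Gamma : {set R}) (C : {set 'rV[R]_n}) :
  principal_left_ideal_ring R ->
  multiplicative P ->
  generator_set Gamma ->
  is_free_left_submodule C ->
  (forall x, x \in C -> x != 0 -> P x) ->
  exists (lt : rel R) (b : 'I_n -> 'rV[R]_n),
    [/\ strict_total_order lt, respectful lt, is_ordered_basis b &
        C \subset lexicode lt b P Gamma].
Proof.
move=> pR _ [Gamma0 _] [[C0 [CD CZ]] [k [e [Ce freeC]]]] PC.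
have EC (c : 'rV_k) : c *m \matrix_i e i \in C.
  rewrite mulmx_sum_row; apply: (big_ind (fun x => x \in C)) => // j _.
  by rewrite rowK; apply/CZ/Ce.
have E_inj : injective (fun c : 'rV_k => c *m \matrix_i e i).
  have sumE (c : 'rV_k) : c *m \matrix_i e i = \sum_(j < k) c 0 j *: e j.
    by rewrite mulmx_sum_row; apply: eq_bigr => j _; rewrite rowK.
  move=> c d ecd; have [f [_ f_uniq]] := freeC _ (EC c).
  by rewrite -(f_uniq c (sumE c)); apply: f_uniq; rewrite -sumE.
(* R^k embeds into R^n and |R| > 1, so cardinalities compare the exponents. *)
have lekn : (k <= n)%N.
  have := leq_card _ E_inj; rewrite !card_mx !mul1n leq_exp2l //.
  by apply/card_gt1P; exists 0, 1; rewrite ?inE // eq_sym oner_neq0.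
have [m def_n] : exists m, n = (k + m)%N by exists (n - k)%N; rewrite subnKC.
subst n; have [B EB] := row_injective_right_inverse pR E_inj.
have [D /injective_rows_basis basis_b] := complete_right_invertible EB.
exists (@ideal_lt R), (fun i => row i (col_mx (\matrix_i e i) D)); split=> //.
- exact: ideal_lt_total.
- exact: ideal_lt_respectful.
have PV : forall x, x \in Vsp (fun i => row i (col_mx (\matrix_i e i) D)) k -> x != 0 -> P x.
  by move=> x /Vsp_col_mx[c ->]; apply/PC/EC.
apply: subset_trans (Vsp_sub_lexicode basis_b (ideal_lt_total R)
  (@ideal_lt_respectful R) Gamma0 lekn PV).
(* Padding the coefficients on [e] with zeros shows that [C] lies in V_k. *)
apply/subsetP=> x /freeC[c [-> _]]; rewrite inE; apply/existsP; exists (row_mx c 0).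
rewrite big_split_ord /= [X in _ == _ + X]big_pred0 ?addr0; last first.
  by move=> j; rewrite /= ltnNge leq_addr.
apply/eqP/esym/eq_big => [i|i _]; first by rewrite /= ltn_ord.
by rewrite row_mxEl rowKu rowK.
Qed.
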